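(* For any map $\iota_X\colon A\to X$ and any integer $k\ge 0$, $$\operatorname{secat} g_k(\iota_X)=\left\lfloor \frac{\operatorname{secat}\iota_X}{k+1}\right\rfloor ,$$ where $g_k(\iota_X)\colon G_k(\iota_X)\to X$ is the $k$-th Ganea map of $\iota_X$.
   Context: Spaces are topological spaces; $\simeq$ denotes homotopy of maps, and all squares below commute up to homotopy. $\lfloor q\rfloor$ is the integer part of $q$. Ganea construction. For a map $\iota_X\colon A\to X$, define maps $g_i=g_i(\iota_X)\colon G_i=G_i(\iota_X)\to X$ for $i\ge 0$ inductively. Start with $G_0=A$ and $g_0=\iota_X$. Given $g_i$, let $F_i$ be the homotopy pullback of $g_i\colon G_i\to X$ and $\iota_X\colon A\to X$, with projections $\beta_i\colon F_i\to G_i$ and $\eta_i\colon F_i\to A$. Let $G_{i+1}$ be the homotopy pushout of $\beta_i$ and $\eta_i$, with structure maps $\gamma_i\colon G_i\to G_{i+1}$ and $\alpha_{i+1}\colon A\to G_{i+1}$. Let $g_{i+1}\colon G_{i+1}\to X$ be the map induced by $g_i$, $\iota_X$ and the homotopy of the pullback square, so that $g_{i+1}\circ\gamma_i\simeq g_i$ and $g_{i+1}\circ\alpha_{i+1}\simeq\iota_X$. That is, $g_{i+1}$ is the join of $g_i$ and $\iota_X$ over $X$. Sectional category. For any map $f\colon B\to X$, $\operatorname{secat} f$ is the least integer $n\ge 0$ such that the $n$-th Ganea map $g_n(f)\colon G_n(f)\to X$ has a homotopy section, i.e. there is $\sigma\colon X\to G_n(f)$ with $g_n(f)\circ\sigma\simeq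 \mathrm{id}_X$. If no such $n$ exists, $\operatorname{secat} f=\infty$, and $\lfloor \infty/(k+1)\rfloor=\infty$. In the claim, $\operatorname{secat} g_k(\iota_X)$ is this invariant applied to the map $f=g_k(\iota_X)$. *)

(* Defs.v *)
From HB Require Import structures.
From Stdlib Require Import Relations.
From mathcomp Require Import all_boot all_order all_algebra generic_quotient.
From mathcomp Require Import all_classical all_reals topology normedtype.
Import numFieldNormedType.Exports.
Import Order.TTheory GRing.Theory Num.Theory.
(* The topology on [continuousType U V] is the compact-open one. *)
Import ArrowAsCompactOpen.

Set Implicit Arguments.
Unset Strict Implicit.
Unset Printing Implicit Defensive.

Local Open Scope classical_set_scope.
Local Open Scope ring_scope.
Local Open Scope quotient_scope.

Section UnitInterval.
Variable R : realType.

Definition unit_itv : topologicalType := set_type (`[0, 1]%classic : set R).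

Lemma unit_itv0_subproof : (0 : R) \in (`[0, 1]%classic : set R).
Proof. by apply/mem_set; rewrite /= in_itv /= lexx ler01. Qed.

Lemma unit_itv1_subproof : (1 : R) \in (`[0, 1]%classic : set R).
Proof. by apply/mem_set; rewrite /= in_itv /= lexx ler01. Qed.

Definition itv0 : unit_itv := exist _ 0 unit_itv0_subproof.
Definition itv1 : unit_itv := exist _ 1 unit_itv1_subproof.

Lemma unit_itv_regular : regular_space unit_itv.
Proof. exact: (@uniform_regular (set_type (`[0, 1]%classic : set R))). Qed.

Lemma unit_itv_compact : compact [set: unit_itv].
Proof.
pose h (x : R) : unit_itv :=
  insubd itv0 x.
have hE x : `[0, 1]%classic x -> val (h x) = x.
  by move=> hx; rewrite /h insubdK //; apply/mem_set.
have -> : [set: unit_itv] = h @` `[0, 1]%classic.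
  rewrite eqEsubset; split=> // -[x hx] _; exists x; first exact: set_mem.
  by apply: val_inj; rewrite hE //; exact: set_mem.
apply: continuous_compact; last exact: segment_compact.
apply/subspace_sigL_continuousP.
rewrite (_ : sigL _ _ = id); first by move=> x; exact: cvg_id.
apply/funext => -[x hx]; apply: val_inj.
by rewrite hE //; exact: set_mem.
Qed.

Lemma unit_itv_locally_compact : locally_compact [set: unit_itv].
Proof.
move=> x _; exists setT; first by rewrite withinET; exact: filterT.
by split; [exact: unit_itv_compact | exact: closedT].
Qed.

End UnitInterval.

Definition homotopic (R : realType) (Y Z : topologicalType) (f g : Y -> Z) :=
  exists H : Y * unit_itv R -> Z,
    [/\ continuous H, forall y, H (y, itv0 R) = f y
      & forall y, H (y, itv1 R) = g y].

Definition has_homotopy_section (R : realType) (Y Z : topologicalType)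
    (p : Y -> Z) :=
  exists s : Z -> Y, continuous s /\ homotopic R (p \o s) idfun.

(* Standard homotopy pullback: triples [(y, c, a)] with [c] a path in [X] from
   [g y] to [f a]. *)
Section HomotopyPullback.
Variables (R : realType) (G A X : topologicalType) (g : G -> X) (f : A -> X).

Definition hpullback_set : set (G * continuousType (unit_itv R) X * A) :=
  [set w : G * continuousType (unit_itv R) X * A |
    w.1.2 (itv0 R) = g w.1.1 /\ w.1.2 (itv1 R) = f w.2].

Definition hpullback : topologicalType := set_type hpullback_set.

Definition hpullback_val (w : hpullback) :
  G * continuousType (unit_itv R) X * A := val w.

Definition hpullback_fst (w : hpullback) : G := (hpullback_val w).1.1.
Definition hpullback_snd (w : hpullback) : A := (hpullback_val w).2.
Definition hpullback_htpy (wt : hpullback * unit_itv R) : X :=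
  (hpullback_val wt.1).1.2 wt.2.

Lemma hpullback_val_continuous : continuous hpullback_val.
Proof. exact: initial_continuous. Qed.

Lemma hpullback_fst_continuous : continuous hpullback_fst.
Proof.
move=> w; apply: (@continuous_comp _ _ _ hpullback_val (fst \o fst)).
  exact: hpullback_val_continuous.
by apply: (@continuous_comp _ _ _ fst fst); exact: cvg_fst.
Qed.

Lemma hpullback_snd_continuous : continuous hpullback_snd.
Proof.
move=> w; apply: (@continuous_comp _ _ _ hpullback_val snd).
  exact: hpullback_val_continuous.
exact: cvg_snd.
Qed.

Lemma hpullback_htpy_continuous : continuous hpullback_htpy.
Proof.
move=> [w t].
apply: (@continuous_comp _ _ _
  (fun wt : hpullback * unit_itv R => ((hpullback_val wt.1).1.2, wt.2)) eval).
  have c1 : {for (w, t), continuous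
      ((snd \o fst) \o (hpullback_val \o (@fst hpullback (unit_itv R))))}.
    apply: continuous_comp.
      by apply: continuous_comp; [exact: cvg_fst | exact: hpullback_val_continuous].
    by apply: continuous_comp; [exact: cvg_fst | exact: cvg_snd].
  exact: (cvg_pair c1 cvg_snd).
by apply: eval_continuous;
  [exact: unit_itv_locally_compact | exact: unit_itv_regular].
Qed.

Lemma hpullback_square :
  homotopic R (g \o hpullback_fst) (f \o hpullback_snd).
Proof.
exists hpullback_htpy; split; first exact: hpullback_htpy_continuous.
- by case=> w hw; have [] := set_mem hw.
- by case=> w hw; have [] := set_mem hw.
Qed.

End HomotopyPullback.

(* Standard homotopy pushout (double mapping cylinder): the quotient of the
   topological sum of [F * [0, 1]], [G] and [A], indexed by [None],
   [Some true] and [Some false], by the equivalence relation generated by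
   [(w, 0) ~ b w] and [(w, 1) ~ e w]. *)
Section HomotopyPushout.
Variables (R : realType) (F G A : topologicalType) (b : F -> G) (e : F -> A).

Definition hpushout_summand (i : option bool) : topologicalType :=
  match i with
  | None => (F * unit_itv R)%type
  | Some true => G
  | Some false => A
  end.

Definition hpushout_sum : topologicalType := {i & hpushout_summand i}.

Definition sum_cyl (wt : F * unit_itv R) : hpushout_sum :=
  existT hpushout_summand None wt.
Definition sum_inl (y : G) : hpushout_sum :=
  existT hpushout_summand (Some true) y.
Definition sum_inr (a : A) : hpushout_sum :=
  existT hpushout_summand (Some false) a.

Inductive hpushout_glue : hpushout_sum -> hpushout_sum -> Prop :=
  | hpushout_glue0 w : hpushout_glue (sum_cyl (w, itv0 R)) (sum_inl (b w))
  | hpushout_glue1 w : hpushout_glue (sum_cyl (w, itv1 R)) (sum_inr (e w)).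

Definition hpushout_relb : rel hpushout_sum :=
  fun x y => `[< clos_refl_sym_trans _ hpushout_glue x y >].

Lemma hpushout_relb_refl : reflexive hpushout_relb.
Proof. by move=> x; apply/asboolP; exact: rst_refl. Qed.

Lemma hpushout_relb_sym : symmetric hpushout_relb.
Proof. by move=> x y; apply/asboolP/asboolP; exact: rst_sym. Qed.

Lemma hpushout_relb_trans : transitive hpushout_relb.
Proof.
move=> y x z /asboolP xy /asboolP yz; apply/asboolP; exact: rst_trans xy yz.
Qed.

Definition hpushout_rel :=
  EquivRel hpushout_relb hpushout_relb_refl hpushout_relb_sym
    hpushout_relb_trans.

Definition hpushout : topologicalType :=
  quotient_topology {eq_quot hpushout_rel}.

Definition hpushout_pi (x : hpushout_sum) : hpushout :=
  \pi_({eq_quot hpushout_rel}) x.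

Definition hpushout_inl (y : G) : hpushout := hpushout_pi (sum_inl y).
Definition hpushout_inr (a : A) : hpushout := hpushout_pi (sum_inr a).

Lemma hpushout_piP x y :
  hpushout_pi x = hpushout_pi y <-> clos_refl_sym_trans _ hpushout_glue x y.
Proof.
split; first by move=> /eqmodP /asboolP.
by move=> h; apply/eqmodP/asboolP.
Qed.

Lemma hpushout_pi_continuous : continuous hpushout_pi.
Proof. exact: (@pi_continuous _ {eq_quot hpushout_rel}). Qed.

Lemma hpushout_inl_continuous : continuous hpushout_inl.
Proof.
move=> y; apply: (@continuous_comp _ _ _ sum_inl hpushout_pi).
  exact: existT_continuous.
exact: hpushout_pi_continuous.
Qed.

Lemma hpushout_inr_continuous : continuous hpushout_inr.
Proof.
move=> y; apply: (@continuous_comp _ _ _ sum_inr hpushout_pi).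
  exact: existT_continuous.
exact: hpushout_pi_continuous.
Qed.

Lemma hpushout_square : homotopic R (hpushout_inl \o b) (hpushout_inr \o e).
Proof.
exists (hpushout_pi \o sum_cyl); split.
- move=> wt; apply: (@continuous_comp _ _ _ sum_cyl hpushout_pi).
    exact: existT_continuous.
  exact: hpushout_pi_continuous.
- by move=> w; apply/hpushout_piP/rst_step; constructor.
- by move=> w; apply/hpushout_piP/rst_step; constructor.
Qed.

(* Map out of the homotopy pushout induced by [u : G -> X], [v : A -> X] and a
   homotopy [H] from [u \o b] to [v \o e]. *)
Section Induced.
Variables (X : topologicalType) (u : G -> X) (v : A -> X)
  (H : F * unit_itv R -> X).

Definition hpushout_summand_map (i : option bool) : hpushout_summand i -> X :=
  match i return hpushout_summand i -> X with
  | None => H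
  | Some true => u
  | Some false => v
  end.

Definition hpushout_ind (z : hpushout) : X :=
  hpushout_summand_map (projT2 (repr (z : {eq_quot hpushout_rel}))).

Hypothesis H0 : forall w, H (w, itv0 R) = u (b w).
Hypothesis H1 : forall w, H (w, itv1 R) = v (e w).

Lemma hpushout_ind_pi x :
  hpushout_ind (hpushout_pi x) = hpushout_summand_map (projT2 x).
Proof.
rewrite /hpushout_ind; set r := repr _.
have /hpushout_piP : hpushout_pi r = hpushout_pi x.
  exact: (reprK (hpushout_pi x : {eq_quot hpushout_rel})).
elim=> [_ _ [w|w]|//|p q _ -> //|p q s _ -> _ -> //].
- exact: H0.
- exact: H1.
Qed.

Lemma hpushout_ind_inl y : hpushout_ind (hpushout_inl y) = u y.
Proof. exact: hpushout_ind_pi. Qed.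

Lemma hpushout_ind_inr a : hpushout_ind (hpushout_inr a) = v a.
Proof. exact: hpushout_ind_pi. Qed.

Lemma hpushout_ind_continuous :
  continuous u -> continuous v -> continuous H -> continuous hpushout_ind.
Proof.
move=> cu cv cH.
apply/(@quotient_continuous _ {eq_quot hpushout_rel}).
rewrite (_ : _ \o _ = fun x => hpushout_summand_map (projT2 x)); last first.
  by apply/funext => x; exact: hpushout_ind_pi.
by apply: sigT_continuous => -[[]|].
Qed.

End Induced.
End HomotopyPushout.

Section Ganea.
Variables (R : realType) (A X : topologicalType) (f : A -> X).

Record map_over := MapOver {
  over_space : topologicalType;
  over_map : over_space -> X }.

(* The join over [X] of [p] and [f]. *)
Definition fiber_join (p : map_over) : map_over :=
  @MapOver
    (hpushout R (@hpullback_fst R _ _ _ (over_map (m := p)) f)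
                (@hpullback_snd R _ _ _ (over_map (m := p)) f))
    (hpushout_ind (over_map (m := p)) f
      (@hpullback_htpy R _ _ _ (over_map (m := p)) f)).

Definition ganea (i : nat) : map_over := iter i fiber_join (MapOver f).

Definition ganea_space (i : nat) : topologicalType := over_space (ganea i).
Definition ganea_map (i : nat) : ganea_space i -> X := over_map (m := ganea i).

Definition ganea_gamma (i : nat) : ganea_space i -> ganea_space i.+1 :=
  @hpushout_inl R _ _ _
    (@hpullback_fst R _ _ _ (@ganea_map i) f)
    (@hpullback_snd R _ _ _ (@ganea_map i) f).
Definition ganea_alpha (i : nat) : A -> ganea_space i.+1 :=
  @hpushout_inr R _ _ _
    (@hpullback_fst R _ _ _ (@ganea_map i) f)
    (@hpullback_snd R _ _ _ (@ganea_map i) f).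

Lemma ganea_map_gamma i y : @ganea_map i.+1 (@ganea_gamma i y) = @ganea_map i y.
Proof.
apply: hpushout_ind_inl => -[w hw]; have [h0 h1] := set_mem hw.
- exact: h0.
- exact: h1.
Qed.

Lemma ganea_map_alpha i a : @ganea_map i.+1 (@ganea_alpha i a) = f a.
Proof.
apply: hpushout_ind_inr => -[w hw]; have [h0 h1] := set_mem hw.
- exact: h0.
- exact: h1.
Qed.

Lemma ganea_map_continuous i : continuous f -> continuous (@ganea_map i).
Proof.
move=> cf; elim: i => [//|i IH].
apply: hpushout_ind_continuous => //.
- by case=> w hw; have [] := set_mem hw.
- by case=> w hw; have [] := set_mem hw.
- exact: hpullback_htpy_continuous.
Qed.

(* [None] stands for infinity. *)
Definition secat : option nat :=
  match pselect (exists n, `[< has_homotopy_section R (@ganea_map n) >]) with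
  | left ex_sec => Some (ex_minn ex_sec)
  | right _ => None
  end.

End Ganea.

(* Main.v *)
(* Let a map [phi : Z -> X] be "liftable" through [p : P -> X] if [p \o s] is
   homotopic to [phi] for some [s].  A map [phi] lifts through the join of [p]
   and [q] over [X] if and only if there are two continuous functions
   [a, b : Z -> [0, oo[] without common zero such that [phi] restricted to
   [{a > 0}] lifts through [p] and [phi] restricted to [{b > 0}] lifts through
   [q]: the join coordinate provides the functions, and conversely they
   provide a join coordinate.  The right-hand side is an associative operation
   on properties of maps into [X], so lifting through [g_n(f)] is the
   [n+1]-fold power of lifting through [f].  Hence lifting through
   [g_n(g_k(iota))] is the [(n+1)(k+1)]-fold power of lifting through [iota],
   i.e. [g_n(g_k(iota))] and [g_(n(k+1)+k)(iota)] have homotopy sections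
   simultaneously, although no homotopy equivalence between their sources is
   ever constructed. *)
Require Import Defs.
From mathcomp Require Import all_boot all_order all_algebra.
From mathcomp Require Import all_classical all_reals topology normedtype.
From mathcomp Require Import lra zify.
Import numFieldNormedType.Exports.
Import Order.TTheory GRing.Theory Num.Theory.
Import ArrowAsCompactOpen.

Set Implicit Arguments.
Unset Strict Implicit.
Unset Printing Implicit Defensive.

Local Open Scope classical_set_scope.
Local Open Scope ring_scope.

(** * Topological preliminaries *)

Section Continuity.
Implicit Types S T U V Z : topologicalType.

Lemma continuous_compT S T U (f : S -> T) (g : T -> U) :
  continuous f -> continuous g -> continuous (g \o f).
Proof. by move=> cf cg x; apply: continuous_comp; [exact: cf|exact: cg]. Qed.

Lemma continuous_pair S T U (f : S -> T) (g : S -> U) :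
  continuous f -> continuous g -> continuous (fun x => (f x, g x)).
Proof. by move=> cf cg x; exact: cvg_pair (cf x) (cg x). Qed.

Lemma continuous_fstT S T : continuous (@fst S T).
Proof. by move=> x; exact: cvg_fst. Qed.

Lemma continuous_sndT S T : continuous (@snd S T).
Proof. by move=> x; exact: cvg_snd. Qed.

Lemma continuous_val Z (U : set Z) : continuous (\val : U -> Z).
Proof. exact: initial_continuous. Qed.

Lemma continuous_into_set T Z (U : set Z) (f : T -> U) :
  continuous (\val \o f) -> continuous f.
Proof. exact: continuous_comp_initial. Qed.

Lemma set_typeP Z (U : set Z) (x : U) : U (\val x).
Proof. exact: set_mem (valP x). Qed.

Definition set_sub Z (U : set Z) z (Uz : U z) : U := exist _ z (mem_set Uz).

Definition set_map Z T (U : set Z) (V : set T) (f : Z -> T)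
  (fUV : forall z, U z -> V (f z)) (x : U) : V := set_sub (fUV _ (set_typeP x)).

Lemma set_map_continuous Z T (U : set Z) (V : set T) (f : Z -> T) fUV :
  continuous f -> continuous (@set_map Z T U V f fUV).
Proof.
move=> cf; apply: continuous_into_set.
apply: (@continuous_compT U Z T \val f) => //.
exact: continuous_val.
Qed.

Lemma continuous_at_open_subset Z T (U : set Z) (f : Z -> T) (z : Z) :
  open U -> continuous (f \o \val : U -> T) -> U z -> {for z, continuous f}.
Proof.
move=> oU cf Uz.
have : {within U, continuous f} by apply/subspace_sigL_continuousP.
by rewrite continuous_open_subspace // => /(_ _ (mem_set Uz)).
Qed.

(* [S z t] specifies the value at [z] of the glued map. *)
Lemma glue_open Z T (S : Z -> T -> Prop) :
  (forall z t t', S z t -> S z t' -> t = t') ->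
  (forall z, exists U : set Z, [/\ open U, U z &
     exists2 g : U -> T, continuous g & forall x : U, S (\val x) (g x)]) ->
  exists2 f : Z -> T, continuous f & forall z, S z (f z).
Proof.
move=> Sfun Sloc.
have /choice[f fS] z : exists t, S z t.
  have [U [_ Uz [g _ gS]]] := Sloc z.
  by exists (g (set_sub Uz)); exact: (gS (set_sub Uz)).
exists f => // z; have [U [oU Uz [g cg gS]]] := Sloc z.
apply: (continuous_at_open_subset oU) => //.
rewrite (_ : _ \o _ = g) //; apply/funext => x /=.
exact: Sfun (fS _) (gS x).
Qed.

End Continuity.

Section RealFunctions.
Variables (R : realType) (Z : topologicalType).
Implicit Types f g : Z -> R.

Lemma open_preimage_lt f c : continuous f -> open [set z | f z < c].
Proof.
move=> cf; apply: (@open_comp _ _ f [set x | x < c]) => [x _|]; first exact: cf.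
exact: open_lt.
Qed.

Lemma open_preimage_gt f c : continuous f -> open [set z | c < f z].
Proof.
move=> cf; apply: (@open_comp _ _ f [set x | c < x]) => [x _|]; first exact: cf.
exact: open_gt.
Qed.

Lemma continuous_if_le (T : topologicalType) f c (g h : Z -> T) :
  continuous f -> continuous g -> continuous h ->
  (forall z, f z = c -> g z = h z) ->
  continuous (fun z => if f z <= c then g z else h z).
Proof.
move=> cf cg ch gh z W; rewrite nbhs_simpl /=.
have [fc|fc|fc] := ltgtP (f z) c => zW; near=> y => /=.
- have -> : f y <= c.
    apply: ltW; near: y; apply: (@open_nbhs_nbhs _ z [set y | f y < c]).
    by split => //; exact: open_preimage_lt.
  by near: y; exact: cg.
- have /negbTE -> : ~~ (f y <= c).
    rewrite -ltNge; near: y; apply: (@open_nbhs_nbhs _ z [set y | c < f y]).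
    by split => //; exact: open_preimage_gt.
  by near: y; exact: ch.
- by case: ifP => _; near: y; [exact: cg|apply: ch; rewrite -gh].
Unshelve. all: by end_near. Qed.

(* The minimum with [a] makes the extension by zero continuous even if [v] is
   unbounded. *)
Lemma extend_cozero (a : Z -> R) (v : [set z | 0 < a z] -> R) :
  continuous a -> (forall z, 0 <= a z) -> continuous v -> (forall x, 0 <= v x) ->
  exists w : Z -> R, [/\ continuous w, forall z, 0 <= w z &
    forall z, 0 < w z <-> exists2 x, \val x = z & 0 < v x].
Proof.
move=> ca a0 cv v0.
pose w z := if pselect (0 < a z) is left az
            then Num.min (a z) (v (@set_sub _ [set z | 0 < a z] _ az)) else 0.
have wE (x : [set z | 0 < a z]) : w (\val x) = Num.min (a (\val x)) (v x).
  rewrite /w; case: pselect => [ax|[]]; last exact: (set_typeP x).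
  by congr (Num.min _ (v _)); exact: val_inj.
have w0 z : 0 <= w z.
  by rewrite /w; case: pselect => // az; rewrite le_min a0 v0.
have wa z : w z <= a z.
  by rewrite /w; case: pselect => // az; rewrite ge_min lexx.
exists w; split => //.
(* Where [a] vanishes, [w] is squeezed between 0 and [a]; elsewhere continuity is local on the open
   set where [a] is positive. *)
- move=> z; have := a0 z; rewrite le_eqVlt => /predU1P[az|az].
    have wz : w z = 0 by apply/eqP; rewrite eq_le w0 andbT az wa.
    move: (ca z); rewrite /continuous_at wz -az => caz.
    apply: (@squeeze_cvgr _ _ _ _ (cst 0) a) => //.
      by apply: nearW => y; rewrite w0 wa.
    exact: cvg_cst.
  apply: (@continuous_at_open_subset _ _ [set z | 0 < a z]) => //.
    exact: open_preimage_gt.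
  rewrite (_ : _ \o _ = (a \o \val) \min v); last by apply/funext => x; exact: wE.
  apply: min_fun_continuous => //.
  by apply: continuous_compT => //; exact: continuous_val.
- move=> z; split=> [|[x <- vx]]; last first.
    by rewrite wE lt_min vx andbT; exact: (set_typeP x).
  have [az|az] := pselect (0 < a z).
    pose x : [set z | 0 < a z] := @set_sub _ [set z | 0 < a z] _ az.
    rewrite -[z]/(\val x) wE lt_min => /andP[_ ?]; by exists x.
  by move=> wz; case: az; exact: lt_le_trans wz (wa z).
Qed.

End RealFunctions.

(** * Paths and homotopies *)

Section Interval.
Variable R : realType.
Let I := unit_itv R.

Lemma clamp_subproof (r : R) :
  (`[0, 1]%classic : set R) (Num.max 0 (Num.min 1 r)).
Proof.
rewrite /= in_itv /= le_max lexx /=.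
by rewrite ge_max ler01 ge_min lexx.
Qed.

(** A total retraction onto the unit interval, so that reparametrizations can be written as real
    formulas without range conditions. *)
Definition clamp (r : R) : I := set_sub (clamp_subproof r).

Lemma clamp_continuous : continuous clamp.
Proof.
apply: continuous_into_set.
rewrite (_ : _ \o _ = cst (0 : R) \max (cst (1 : R) \min id)) //.
apply: max_fun_continuous; first exact: cst_continuous.
apply: min_fun_continuous; first exact: cst_continuous.
by move=> x; exact: cvg_id.
Qed.

Lemma unit_itv_ge0 (t : I) : 0 <= \val t.
Proof. by have := set_mem (valP t); rewrite /= in_itv /= => /andP[]. Qed.

Lemma unit_itv_le1 (t : I) : \val t <= 1.
Proof. by have := set_mem (valP t); rewrite /= in_itv /= => /andP[]. Qed.

Lemma val_clamp r : 0 <= r <= 1 -> \val (clamp r) = r.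
Proof. by move=> /andP[r0 r1]; rewrite /= min_r // max_r. Qed.

Lemma clampK (t : I) : clamp (\val t) = t.
Proof. by apply: val_inj; rewrite val_clamp // unit_itv_ge0 unit_itv_le1. Qed.

Lemma clamp_le0 r : r <= 0 -> clamp r = itv0 R.
Proof.
by move=> r0; apply: val_inj; rewrite /= min_r ?max_l // (le_trans r0).
Qed.

Lemma clamp_ge1 r : 1 <= r -> clamp r = itv1 R.
Proof. by move=> r1; apply: val_inj; rewrite /= min_l // max_r. Qed.

Lemma val_clamp_continuous (T : topologicalType) (r : T -> R) :
  continuous r -> continuous (fun x => \val (clamp (r x)) : R).
Proof.
move=> cr; apply: (@continuous_compT T I R (clamp \o r) \val).
  by apply: (continuous_compT cr); exact: clamp_continuous.
exact: continuous_val.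
Qed.

End Interval.

Section Paths.
Variables (R : realType) (Z X : topologicalType).
Let I := unit_itv R.

Lemma curry_path (H : Z * I -> X) : continuous H ->
  exists2 c : Z -> continuousType I X,
    continuous c & forall z t, c z t = H (z, t).
Proof.
move=> cH; have [cc ch] := continuous_curry cH.
by exists (fun z => mkcts (ch z)) => //; apply: continuous_comp_initial.
Qed.

Lemma uncurry_path (c : Z -> continuousType I X) : continuous c ->
  continuous (fun zt : Z * I => c zt.1 zt.2).
Proof.
move=> cc.
apply: (@continuous_compT _ _ _ (fun zt : Z * I => (c zt.1, zt.2)) eval).
  apply: continuous_pair; last exact: continuous_sndT.
  by apply: continuous_compT cc; exact: continuous_fstT.
by apply: eval_continuous;
  [exact: unit_itv_locally_compact | exact: unit_itv_regular].
Qed.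

Lemma reparam_continuous (H : Z * I -> X) (T : topologicalType)
    (f : T -> Z) (r : T -> R) :
  continuous H -> continuous f -> continuous r ->
  continuous (fun x => H (f x, clamp (r x))).
Proof.
move=> cH cf cr; apply: (@continuous_compT _ _ _ _ H) => //.
apply: continuous_pair => //.
by apply: (continuous_compT cr); exact: clamp_continuous.
Qed.

(* The path [H] at double speed, followed by the reverse of [K]. *)
Lemma concat_reverse (H K : Z * I -> X) : continuous H -> continuous K ->
  (forall z, H (z, itv1 R) = K (z, itv1 R)) ->
  exists2 L : Z * I -> X, continuous L &
    forall z t, L (z, clamp (\val t / 2)) = H (z, t) /\
                L (z, clamp (1 - \val t / 2)) = K (z, t).
Proof.
move=> cH cK HK.
have cval : continuous (fun zt : Z * I => \val zt.2 : R).
  by apply: continuous_compT; [exact: continuous_sndT|exact: continuous_val].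
exists (fun zt => if \val zt.2 <= 2^-1 then H (zt.1, clamp (2 * \val zt.2))
                  else K (zt.1, clamp (2 - 2 * \val zt.2))).
  apply: continuous_if_le => //.
  - apply: reparam_continuous => //; first exact: continuous_fstT.
    by move=> x; apply: cvgM; [exact: cvg_cst|exact: cval].
  - apply: reparam_continuous => //; first exact: continuous_fstT.
    move=> x; apply: cvgB; first exact: cvg_cst.
    by apply: cvgM; [exact: cvg_cst|exact: cval].
  - by move=> [z t] /= ->; rewrite !clamp_ge1 //; lra.
move=> z t; have t0 := unit_itv_ge0 t; have t1 := unit_itv_le1 t.
have tE := clampK t; move: (\val t : R) t0 t1 tE => r r0 r1 <-.
rewrite [(z, _).1]/= [(z, _).2]/= !val_clamp; try (apply/andP; split; lra).
split.
  have -> : r / 2 <= 2^-1 by lra.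
  by rewrite (_ : 2 * _ = r) //; lra.
(* The first branch is reached only for [r = 1], where [H] and [K] agree. *)
case: leP => h; last by rewrite (_ : 2 - _ = r) //; lra.
rewrite /= clamp_ge1; last by lra.
by rewrite HK [in RHS]clamp_ge1 //; lra.
Qed.

End Paths.

Section Homotopic.
Variables (R : realType) (Z X : topologicalType).
Implicit Types f g h : Z -> X.

(** Transitivity and symmetry at once: symmetry is the case where the first homotopy is constant. *)
Lemma homotopic_trans_sym f g h :
  homotopic R f g -> homotopic R h g -> homotopic R f h.
Proof.
move=> [H [cH H0 H1]] [K [cK K0 K1]].
have [z|L cL LE] := concat_reverse cH cK; first by rewrite H1 K1.
exists L; split => // z.
  by rewrite -H0 -(LE z _).1 mul0r clamp_le0.
by rewrite -K0 -(LE z _).2 mul0r subr0 clamp_ge1.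
Qed.

Lemma homotopic_refl f : continuous f -> homotopic R f f.
Proof.
move=> cf; exists (f \o fst); split => //.
by apply: (continuous_compT _ cf); exact: continuous_fstT.
Qed.

(** The constant homotopy used for symmetry needs a continuous map; the homotopy itself provides the
    continuity. *)
Lemma homotopic_end f g : homotopic R f g -> continuous g.
Proof.
move=> [H [cH _ H1]]; rewrite (_ : g = fun z => H (z, itv1 R)).
  apply: (continuous_compT _ cH); apply: continuous_pair => [x|].
    exact: cvg_id.
  exact: cst_continuous.
by apply/funext => z; rewrite H1.
Qed.

Lemma homotopic_sym f g : homotopic R f g -> homotopic R g f.
Proof.
move=> fg; have cg := homotopic_end fg.
exact: homotopic_trans_sym (homotopic_refl cg) fg.
Qed.

Lemma homotopic_precomp (T : topologicalType) (j : T -> Z) f g :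
  continuous j -> homotopic R f g -> homotopic R (f \o j) (g \o j).
Proof.
move=> cj [H [cH H0 H1]]; exists (fun xt => H (j xt.1, xt.2)); split.
- apply: (continuous_compT _ cH); apply: continuous_pair.
    by apply: (continuous_compT _ cj); exact: continuous_fstT.
  exact: continuous_sndT.
- by move=> x; exact: H0.
- by move=> x; exact: H1.
Qed.

End Homotopic.

(** * Lifting through a join *)

Section Lifts.
Variables (R : realType) (X P : topologicalType) (p : P -> X).
Let I := unit_itv R.

Definition lifts (Z : topologicalType) (phi : Z -> X) :=
  exists2 s : Z -> P, continuous s & homotopic R (p \o s) phi.

(** With the homotopy stored as a family of paths, a lift and its homotopy form a single map into a
    product and can be glued together. *)
Lemma lifts_pathP (Z : topologicalType) (phi : Z -> X) :
  lifts phi <-> exists s (c : Z -> continuousType I X),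
    [/\ continuous s, continuous c, forall z, c z (itv0 R) = p (s z)
      & forall z, c z (itv1 R) = phi z].
Proof.
split=> [[s cs [H [/curry_path[c cc cE] H0 H1]]]|[s [c [cs cc c0 c1]]]].
  by exists s, c; split => // z; rewrite cE.
exists s => //; exists (fun zt => c zt.1 zt.2); split => //.
exact: uncurry_path.
Qed.

Lemma lifts_precomp (Y Z : topologicalType) (j : Y -> Z) (phi : Z -> X) :
  continuous j -> lifts phi -> lifts (phi \o j).
Proof.
move=> cj [s cs sphi]; exists (s \o j); first exact: continuous_compT.
exact: homotopic_precomp sphi.
Qed.

Lemma lifts_homotopic (Z : topologicalType) (phi psi : Z -> X) :
  homotopic R phi psi -> lifts phi -> lifts psi.
Proof.
move=> pp [s cs sphi]; exists s => //.
exact: homotopic_trans_sym sphi (homotopic_sym pp).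
Qed.

End Lifts.

Section JoinLifts.
Variables (R : realType) (X P Q : topologicalType) (p : P -> X) (q : Q -> X).
Let I := unit_itv R.
Let C : topologicalType := continuousType I X.
Let F := hpullback R p q.
Let J := hpushout R (@hpullback_fst R _ _ _ p q) (@hpullback_snd R _ _ _ p q).
Let j : J -> X := hpushout_ind p q (@hpullback_htpy R _ _ _ p q).

Let pi : hpushout_sum R F P Q -> J := @hpushout_pi R F P Q _ _.

Lemma hpullback_lift (W : topologicalType) (s : W -> P) (t : W -> Q)
    (c : W -> C) :
  continuous s -> continuous t -> continuous c ->
  (forall x, c x (itv0 R) = p (s x)) -> (forall x, c x (itv1 R) = q (t x)) ->
  exists2 w : W -> F, continuous w &
    forall x, hpullback_val (w x) = (s x, c x, t x).
Proof.
move=> cs ct cc c0 c1.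
exists (fun x => @set_sub _ (hpullback_set p q) (s x, c x, t x)
  (conj (c0 x) (c1 x))) => //.
apply: continuous_into_set.
by apply: continuous_pair => //; exact: continuous_pair.
Qed.

Lemma join_pi x : j (pi x) =
  hpushout_summand_map p q (@hpullback_htpy R _ _ _ p q) (projT2 x).
Proof.
by apply: hpushout_ind_pi => -[w hw]; have [] := set_mem hw.
Qed.

(** Where both lifts exist, their homotopies to [phi] concatenate to a path from [p \o s] to
    [q \o t], that is, to a point of the homotopy pullback. A rescaling of [b / (a + b)] then serves
    as join coordinate. *)
Lemma lifts_join_glue (Z : topologicalType) (phi : Z -> X) (a b : Z -> R) :
  continuous a -> continuous b -> (forall z, 0 <= a z) -> (forall z, 0 <= b z) ->
  (forall z, 0 < a z \/ 0 < b z) ->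
  lifts R p (phi \o (\val : [set z | 0 < a z] -> Z)) ->
  lifts R q (phi \o (\val : [set z | 0 < b z] -> Z)) ->
  lifts R j phi.
Proof.
move=> ca cb a0 b0 ab.
set U := [set z | 0 < a z]; set V := [set z | 0 < b z].
move=> /lifts_pathP[s [g [cs cg gl gr]]] /lifts_pathP[t [d [ct cd dl dr]]].
have oW : open (U `&` V) by apply: openI; exact: open_preimage_gt.
pose iU : (U `&` V)%classic -> U := set_map (@subIsetl _ U V).
pose iV : (U `&` V)%classic -> V := set_map (@subIsetr _ U V).
have ciU : continuous iU by apply: set_map_continuous => x; exact: cvg_id.
have ciV : continuous iV by apply: set_map_continuous => x; exact: cvg_id.
have [|||L cL LE] := @concat_reverse R _ _
    (fun xr => g (iU xr.1) xr.2) (fun xr => d (iV xr.1) xr.2).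
- by apply: (@uncurry_path _ _ _ (g \o iU)); exact: continuous_compT.
- by apply: (@uncurry_path _ _ _ (d \o iV)); exact: continuous_compT.
- by move=> x /=; rewrite gr dr.
have [l cl lE] := curry_path cL.
have [|||||w cw wE] := @hpullback_lift _ (s \o iU) (t \o iV) l.
- exact: continuous_compT.
- exact: continuous_compT.
- exact: cl.
- move=> x; rewrite lE -gl -(LE x _).1 mul0r clamp_le0 //.
- move=> x; rewrite lE -dl -(LE x _).2 mul0r subr0 clamp_ge1 //.
pose u z := b z / (a z + b z).
have ab0 z : 0 < a z + b z.
  by have := a0 z; have := b0 z; case: (ab z); lra.
have cu : continuous u.
  move=> z; apply: cvgM; first exact: cb.
  apply: cvgV; first by rewrite gt_eqF.
  by apply: cvgD; [exact: ca|exact: cb].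
have uE z : u z * (a z + b z) = b z by rewrite mulfVK // gt_eqF.
have uU z : u z < 1 -> U z.
  move=> u1; rewrite /U /= lt_neqAle a0 andbT; apply/eqP => az.
  move: u1; rewrite /u -az add0r divff ?ltxx //.
  by have := ab0 z; rewrite -az add0r => /gt_eqF ->.
have uV z : 0 < u z -> V z.
  rewrite /V /= => u0; rewrite -uE; exact: mulr_gt0.
(* After clamping, this is 0 for [u] up to 1/3 and 1 from 2/3 on, so the cylinder piece agrees with
   the end pieces on open overlaps. *)
pose r z := 3 * u z - 1.
have cr : continuous r.
  move=> z; apply: cvgB; last exact: cvg_cst.
  by apply: cvgM; [exact: cvg_cst|exact: cu].
have crv : continuous (r \o (\val : (U `&` V)%classic -> Z)).
  by apply: (continuous_compT _ cr); exact: continuous_val.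
(* [L] runs from [p \o s] at [0] through [phi] at [1/2] to [q \o t] at [1];
   [K x] is its part between the join coordinate of [x] and [1/2]. *)
have [|K cK KE] := @curry_path R (U `&` V)%classic X
  (fun xv => L (xv.1, clamp (\val (clamp (r (\val xv.1))) +
     \val xv.2 * (2^-1 - \val (clamp (r (\val xv.1))))))).
  have c1 : continuous (fun xv : (U `&` V)%classic * I =>
      \val (clamp (r (\val xv.1))) : R).
    apply: (@val_clamp_continuous R _
      (fun xv : (U `&` V)%classic * I => r (\val xv.1))).
    by apply: (continuous_compT _ crv); exact: continuous_fstT.
  apply: reparam_continuous => //; first exact: continuous_fstT.
  move=> x; apply: cvgD; first exact: c1.
  apply: cvgM.
    by apply: (@continuous_compT _ _ _ snd (\val : I -> R)) x;
      [exact: continuous_sndT|exact: continuous_val].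
  by apply: cvgB; [exact: cvg_cst|exact: c1].
pose m x : J := pi (sum_cyl P Q (w x, clamp (r (\val x)))).
have cm : continuous m.
  apply: (@continuous_compT _ _ _
    (fun x => sum_cyl P Q (w x, clamp (r (\val x)))) pi).
    apply: (@continuous_compT _ _ _ (fun x => (w x, clamp (r (\val x))))
      (@sum_cyl R F P Q)); last by move=> z; exact: existT_continuous.
    apply: continuous_pair => //.
    by apply: (continuous_compT crv); exact: clamp_continuous.
  exact: hpushout_pi_continuous.
(* On [{u < 1/3}], [{u > 2/3}] and [{a > 0} `&` {b > 0}] respectively; the
   second component is a path to [phi], so that the map and the homotopy are
   glued at once. *)
pose h0 (x : U) : J * C := (pi (sum_inl R F Q (s x)), g x).
pose h1 (x : V) : J * C := (pi (sum_inr R F P (t x)), d x).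
pose hm x : J * C := (m x, K x).
have c0 : continuous h0.
  apply: continuous_pair => //.
  apply: (@continuous_compT _ _ _ s (@hpushout_inl R F P Q _ _)) => //.
  exact: hpushout_inl_continuous.
have c1 : continuous h1.
  apply: continuous_pair => //.
  apply: (@continuous_compT _ _ _ t (@hpushout_inr R F P Q _ _)) => //.
  exact: hpushout_inr_continuous.
have chm : continuous hm by exact: continuous_pair.
have E0 (x : U) (y : (U `&` V)%classic) :
    \val x = \val y -> u (\val x) < 3^-1 -> h0 x = hm y.
  move=> xy ux; have {xy ux} [-> ry] : x = iU y /\ r (\val y) <= 0.
    by split; [exact: val_inj|rewrite /r -xy; lra].
  rewrite /h0 /hm /m; congr pair.
    rewrite clamp_le0 //; apply/esym/hpushout_piP.
    have <- : hpullback_fst (w y) = s (iU y) by rewrite /hpullback_fst wE.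
    exact/Relation_Operators.rst_step/hpushout_glue0.
  apply/continuousEP => v.
  rewrite KE [(y, v).1]/= [(y, v).2]/= [clamp (r _)]clamp_le0 //.
  rewrite [\val (itv0 R)]/=.
  by rewrite add0r subr0 (LE y v).1.
have E1 (x : V) (y : (U `&` V)%classic) :
    \val x = \val y -> 2 / 3 < u (\val x) -> h1 x = hm y.
  move=> xy ux; have {xy ux} [-> ry] : x = iV y /\ 1 <= r (\val y).
    by split; [exact: val_inj|rewrite /r -xy; lra].
  rewrite /h1 /hm /m; congr pair.
    rewrite clamp_ge1 //; apply/esym/hpushout_piP.
    have <- : hpullback_snd (w y) = t (iV y) by rewrite /hpullback_snd wE.
    exact/Relation_Operators.rst_step/hpushout_glue1.
  apply/continuousEP => v.
  rewrite KE [(y, v).1]/= [(y, v).2]/= [clamp (r _)]clamp_ge1 //.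
  rewrite [\val (itv1 R)]/=.
  rewrite -(LE y v).2; congr (L (_, clamp _)); lra.
(* [S z T] demands agreement with every piece available at [z]; since the pieces cover [Z], this
   determines [T]. *)
pose S z T := [/\ forall x : U, \val x = z -> u z < 3^-1 -> T = h0 x,
  forall x : V, \val x = z -> 2 / 3 < u z -> T = h1 x
  & forall x : (U `&` V)%classic, \val x = z -> T = hm x].
have cover z : [\/ u z < 3^-1, 2 / 3 < u z | 0 < u z < 1].
  have [?|?] := ltP (u z) 3^-1; first by constructor 1.
  have [?|?] := ltP (2 / 3) (u z); first by constructor 2.
  by constructor 3; lra.
have [f cf fS] : exists2 f, continuous f & forall z, S z (f z).
  apply: glue_open.
    move=> z T T' [S0 S1 S2] [S0' S1' S2']; case: (cover z) => uz.
    - have Uz : U z by apply: uU; lra.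
      by rewrite (S0 (set_sub Uz)) // (S0' (set_sub Uz)).
    - have Vz : V z by apply: uV; lra.
      by rewrite (S1 (set_sub Vz)) // (S1' (set_sub Vz)).
    - have Wz : (U `&` V) z by split; [apply: uU|apply: uV]; lra.
      by rewrite (S2 (set_sub Wz)) // (S2' (set_sub Wz)).
  move=> z; case: (cover z) => uz.
  - exists [set y | u y < 3^-1]; split => //; first exact: open_preimage_lt.
    have sub y : u y < 3^-1 -> U y by move=> uy; apply: uU; lra.
    exists (h0 \o set_map sub).
      apply: (continuous_compT _ c0).
      by apply: set_map_continuous => y; exact: cvg_id.
    move=> x; have ux : u (\val x) < 3^-1 := set_typeP x; split => y xy.
    + by move=> _; congr h0; exact: val_inj.
    + by move=> ?; exfalso; lra.
    + by apply: E0.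
  - exists [set y | 2 / 3 < u y]; split => //; first exact: open_preimage_gt.
    have sub y : 2 / 3 < u y -> V y by move=> uy; apply: uV; lra.
    exists (h1 \o set_map sub).
      apply: (continuous_compT _ c1).
      by apply: set_map_continuous => y; exact: cvg_id.
    move=> x; have ux : 2 / 3 < u (\val x) := set_typeP x; split => y xy.
    + by move=> ?; exfalso; lra.
    + by move=> _; congr h1; exact: val_inj.
    + by apply: E1.
  - have Wz : (U `&` V) z by split; [apply: uU|apply: uV]; lra.
    exists (U `&` V); split => //; exists hm => // x; split => y xy.
    + by rewrite -xy => uy; apply/esym/E0.
    + by rewrite -xy => uy; apply/esym/E1.
    + by congr hm; exact: val_inj.
have fE z : (f z).2 (itv0 R) = j (f z).1 /\ (f z).2 (itv1 R) = phi z.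
  have [S0 S1 S2] := fS z; case: (cover z) => uz.
  - have Uz : U z by apply: uU; lra.
    by rewrite (S0 (set_sub Uz)) // join_pi gl gr.
  - have Vz : V z by apply: uV; lra.
    by rewrite (S1 (set_sub Vz)) // join_pi dl dr.
  - have Wz : (U `&` V) z by split; [apply: uU|apply: uV]; lra.
    rewrite (S2 (set_sub Wz)) // [(hm _).1]/= [(hm _).2]/= join_pi !KE.
    rewrite [(_, _).1]/= [(_, _).2]/= mul0r addr0 clampK; split.
      by rewrite /= /hpullback_htpy wE /= lE.
    (* The path [K] ends at the midpoint of [L], which is the end of [g], hence at [phi]. *)
    rewrite mul1r addrCA subrr addr0 -[2^-1]mul1r.
    by rewrite (LE (set_sub Wz) (itv1 R)).1 /= gr.
apply/lifts_pathP; exists (fst \o f), (snd \o f); split.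
- by apply: (continuous_compT cf); exact: continuous_fstT.
- by apply: (continuous_compT cf); exact: continuous_sndT.
- by move=> z; have [] := fE z.
- by move=> z; have [] := fE z.
Qed.

(* [f] is defined on all summands because its values outside the preimage of
   [U] are irrelevant: they need not be compatible with the gluing. *)
Lemma hpushout_open_map (T : topologicalType) (U : set J)
    (f : hpushout_sum R F P Q -> T) :
  open U -> continuous f ->
  (forall x y, hpushout_glue (@hpullback_fst R _ _ _ p q)
     (@hpullback_snd R _ _ _ p q) x y -> U (pi x) -> f x = f y) ->
  exists2 g : U -> T, continuous g &
    forall (z : U) x, \val z = pi x -> g z = f x.
Proof.
move=> oU cf fglue; pose g (z : J) : T := f (repr z).
(* Related points have the same image under [pi], so membership in [U] persists along a chain of
   gluings. *)
have fE x y : Relation_Operators.clos_refl_sym_trans _ (hpushout_glue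
    (@hpullback_fst R _ _ _ p q) (@hpullback_snd R _ _ _ p q)) x y ->
    U (pi x) -> f x = f y.
  elim=> // {x y} [x y /hpushout_piP xy IH Ux|x y z /hpushout_piP xy IHx _ IHy Ux].
    by rewrite IH // /pi xy.
  by rewrite IHx // IHy // /pi -xy.
have gE x : U (pi x) -> g (pi x) = f x.
  have rx : pi (repr (pi x)) = pi x by exact: (reprK (pi x)).
  by move=> Ux; apply: fE; [exact/hpushout_piP|rewrite rx].
have cg z : U z -> {for z, continuous g}.
  move=> Uz W; rewrite nbhsE => -[O [oO Oz] OW].
  (* Openness in the quotient is tested after pulling back along [pi], where [g \o pi] agrees with
     the continuous [f] over [U]. *)
  suff oN : open (U `&` g @^-1` O).
    have zN : nbhs z (U `&` g @^-1` O) by apply: open_nbhs_nbhs.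
    by rewrite nbhs_simpl /=; apply: filterS zN => y [_ /OW].
  rewrite /open /= /quotient_open openE => x [Ux Ox].
  have n1 : nbhs x (pi @^-1` U) by apply: open_nbhs_nbhs.
  have n2 : nbhs x (f @^-1` O).
    apply: open_nbhs_nbhs; split; last by rewrite /= -gE.
    by apply: open_comp => // y _; exact: cf.
  apply: filterS (filterI n1 n2) => y [Uy Oy]; split => //.
  by rewrite /= (gE y Uy).
exists (g \o \val) => [z|z x zx /=].
  apply: continuous_comp; first exact: continuous_val.
  by apply: cg; exact: set_typeP.
by rewrite zx gE // -zx; exact: set_typeP.
Qed.

Lemma lifts_join_open (B : topologicalType) (m : B -> X) (U : set J)
    (f : hpushout_sum R F P Q -> B * C) :
  open U -> continuous f ->
  (forall x y, hpushout_glue (@hpullback_fst R _ _ _ p q)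
     (@hpullback_snd R _ _ _ p q) x y -> U (pi x) -> f x = f y) ->
  (forall x, U (pi x) -> (f x).2 (itv0 R) = m (f x).1 /\
                         (f x).2 (itv1 R) = j (pi x)) ->
  lifts R m (j \o (\val : U -> J)).
Proof.
move=> oU cf fglue fE.
have [g cg gE] := hpushout_open_map oU cf fglue.
have gend (z : U) : (g z).2 (itv0 R) = m (g z).1 /\
                    (g z).2 (itv1 R) = j (\val z).
  have zE : \val z = pi (repr (\val z)) by rewrite -[LHS]reprK.
  rewrite (gE _ _ zE) [in j _]zE; apply: fE.
  by rewrite -zE; exact: set_typeP.
apply/lifts_pathP; exists (fst \o g), (snd \o g); split.
- by apply: (continuous_compT cg); exact: continuous_fstT.
- by apply: (continuous_compT cg); exact: continuous_sndT.
- by move=> z; have [] := gend z.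
- by move=> z; have [] := gend z.
Qed.

(** The join coordinate; pulled back along a lift, it yields the functions [a] and [b]. *)
Let height : J -> R := @hpushout_ind R F P Q _ _ R
  (cst (0 : R)) (cst (1 : R)) (fun wt : F * unit_itv R => \val wt.2 : R).

Lemma height_pi x : height (pi x) =
  @hpushout_summand_map R F P Q R (cst (0 : R)) (cst (1 : R))
    (fun wt : F * unit_itv R => \val wt.2 : R) _ (projT2 x).
Proof. exact: hpushout_ind_pi. Qed.

Lemma height_continuous : continuous height.
Proof.
apply: hpushout_ind_continuous => //; try exact: cst_continuous.
by apply: (continuous_compT (@continuous_sndT _ _)); exact: continuous_val.
Qed.

Lemma coheight_continuous : continuous (fun z => 1 - height z).
Proof.
apply: (@continuous_compT _ _ _ height (fun x : R => 1 - x)) => [|x].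
  exact: height_continuous.
by apply: cvgB; [exact: cvg_cst|exact: cvg_id].
Qed.

Hypothesis (cp : continuous p) (cq : continuous q).

Lemma const_path (B : topologicalType) (m : B -> X) : continuous m ->
  exists2 k : B -> C, continuous k & forall y t, k y t = m y.
Proof.
move=> cm; have [|k ck kE] := @curry_path R B X (m \o fst); last by exists k.
by apply: (continuous_compT _ cm); exact: continuous_fstT.
Qed.

(** Handles an empty [P] or [Q], which offers no default value for the summand outside the open
    set. *)
Lemma lifts_empty (B Z : topologicalType) (m : B -> X) (phi : Z -> X) :
  (Z -> False) -> lifts R m phi.
Proof.
move=> Z0; exists (fun z => False_rect _ (Z0 z)) => [z|]; first by case: (Z0 z).
by exists (fun zt => False_rect _ (Z0 zt.1)); split => [[z t]|z|z]; case: (Z0 z).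
Qed.

Lemma hpullback_htpy0 (w : F) : hpullback_htpy (w, itv0 R) = p (hpullback_fst w).
Proof. by case: w => w hw; have [] := set_mem hw. Qed.

Lemma hpullback_htpy1 (w : F) : hpullback_htpy (w, itv1 R) = q (hpullback_snd w).
Proof. by case: w => w hw; have [] := set_mem hw. Qed.

Lemma hpullback_reparam (r : unit_itv R * unit_itv R -> R) : continuous r ->
  exists2 h : F * unit_itv R -> C, continuous h &
    forall w t v, h (w, t) v = hpullback_htpy (w, clamp (r (t, v))).
Proof.
move=> cr; have [|h ch hE] := @curry_path R (F * unit_itv R)%type X
  (fun x => hpullback_htpy (x.1.1, clamp (r (x.1.2, x.2)))); last by exists h.
apply: reparam_continuous; first exact: hpullback_htpy_continuous.
  by apply: (@continuous_compT _ _ _ fst fst); exact: continuous_fstT.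
apply: (@continuous_compT _ _ _
  (fun x : F * unit_itv R * unit_itv R => (x.1.2, x.2)) r) => //.
apply: continuous_pair; last exact: continuous_sndT.
by apply: (@continuous_compT _ _ _ fst snd);
  [exact: continuous_fstT|exact: continuous_sndT].
Qed.

Lemma hpushout_summand_map_continuous (T : topologicalType)
    (l : P -> T) (r : Q -> T) (h : F * unit_itv R -> T) :
  continuous l -> continuous r -> continuous h ->
  continuous (fun x : hpushout_sum R F P Q =>
    hpushout_summand_map l r h (projT2 x)).
Proof. by move=> cl cr ch; apply: sigT_continuous => -[[]|]. Qed.

Lemma continuous_val_fst :
  continuous (fun tv : unit_itv R * unit_itv R => \val tv.1 : R).
Proof. exact: continuous_compT (@continuous_fstT _ _) (@continuous_val _ _). Qed.

Lemma continuous_val_snd :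
  continuous (fun tv : unit_itv R * unit_itv R => \val tv.2 : R).
Proof. exact: continuous_compT (@continuous_sndT _ _) (@continuous_val _ _). Qed.

(** Away from the end [Q], a cylinder point slides down to the end [P], and the traversed part of
    its track in [X] is the homotopy. *)
Lemma lifts_join_left :
  lifts R p (j \o (\val : [set z | 0 < 1 - height z] -> J)).
Proof.
have oU : open [set z | 0 < 1 - height z].
  by apply: open_preimage_gt; exact: coheight_continuous.
have [[y0]|P0] := pselect (inhabited P); last first.
  apply: lifts_empty => z; apply: P0.
  have := set_typeP z; rewrite /= -[\val z]reprK -/(pi _) height_pi.
  case: (repr _) => -[[|]|] /= y; first by [].
    by rewrite subrr ltxx.
  by exists; exact: hpullback_fst y.1.
have [k ck kE] := const_path cp.
(* At height [t] the path follows the track from 0 to [t]; it is constant for [t = 0], as the gluing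
   with [P] requires. *)
have [|h ch hE] := @hpullback_reparam (fun tv => \val tv.2 * \val tv.1).
  by move=> x; apply: cvgM; [exact: continuous_val_snd|exact: continuous_val_fst].
(* The constant on the summand [Q] is a default value: there [1 - height] is 0. *)
pose f (x : hpushout_sum R F P Q) : P * C := hpushout_summand_map
  (fun y => (y, k y)) (cst (y0, k y0)) (fun wt => (hpullback_fst wt.1, h wt))
  (projT2 x).
apply: (@lifts_join_open _ _ _ f) => //.
- apply: hpushout_summand_map_continuous; last 2 first.
  + exact: cst_continuous.
  + apply: continuous_pair => //; apply: (@continuous_compT _ _ _ fst).
      exact: continuous_fstT.
    exact: hpullback_fst_continuous.
  + by apply: continuous_pair => // y; exact: cvg_id.
- move=> _ _ [w|w] /=; last by rewrite height_pi /= subrr ltxx.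
  move=> _; rewrite /f /=; congr pair; apply/continuousEP => t.
  by rewrite kE hE /= mulr0 clamp_le0 // hpullback_htpy0.
- case=> -[[|]|] /=; first by move=> y; rewrite join_pi /f /= !kE.
    by move=> y; rewrite height_pi /= subrr ltxx.
  move=> [w t] _; rewrite join_pi /f /= !hE /= mul0r mul1r clampK.
  by rewrite clamp_le0 // hpullback_htpy0.
Qed.

Lemma lifts_join_right :
  lifts R q (j \o (\val : [set z | 0 < height z] -> J)).
Proof.
have oU : open [set z | 0 < height z].
  by apply: open_preimage_gt; exact: height_continuous.
have [[a0]|Q0] := pselect (inhabited Q); last first.
  apply: lifts_empty => z; apply: Q0.
  have := set_typeP z; rewrite /= -[\val z]reprK -/(pi _) height_pi.
  case: (repr _) => -[[|]|] /= y; first by rewrite ltxx.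
    by [].
  by exists; exact: hpullback_snd y.1.
have [k ck kE] := const_path cq.
(* The path follows the track backwards from 1 to [t], and is constant for [t = 1]. *)
have [|h ch hE] := @hpullback_reparam (fun tv => 1 - \val tv.2 * (1 - \val tv.1)).
  move=> x; apply: cvgB; first exact: cvg_cst.
  apply: cvgM; first exact: continuous_val_snd.
  by apply: cvgB; [exact: cvg_cst|exact: continuous_val_fst].
pose f (x : hpushout_sum R F P Q) : Q * C := hpushout_summand_map
  (cst (a0, k a0)) (fun y => (y, k y)) (fun wt => (hpullback_snd wt.1, h wt))
  (projT2 x).
apply: (@lifts_join_open _ _ _ f) => //.
- apply: hpushout_summand_map_continuous.
  + exact: cst_continuous.
  + by apply: continuous_pair => // y; exact: cvg_id.
  + apply: continuous_pair => //; apply: (@continuous_compT _ _ _ fst).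
      exact: continuous_fstT.
    exact: hpullback_snd_continuous.
- move=> _ _ [w|w] /=; first by rewrite height_pi /= ltxx.
  move=> _; rewrite /f /=; congr pair; apply/continuousEP => t.
  by rewrite kE hE /= subrr mulr0 subr0 clamp_ge1 // hpullback_htpy1.
- case=> -[[|]|] /=; first by move=> y; rewrite height_pi /= ltxx.
    by move=> y; rewrite join_pi /f /= !kE.
  move=> [w t] _; rewrite join_pi /f /= !hE /= mul0r subr0 mul1r subKr clampK.
  by rewrite clamp_ge1 // hpullback_htpy1.
Qed.

(** For the forward direction, [s] restricts to the two cozero sets of the join coordinate, and the
    resulting lifts of [j \o s] become lifts of [phi] along the given homotopy. *)
Lemma lifts_joinP (Z : topologicalType) (phi : Z -> X) :
  lifts R j phi <-> exists a b : Z -> R,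
    [/\ continuous a /\ continuous b, forall z, 0 <= a z /\ 0 <= b z,
      forall z, 0 < a z \/ 0 < b z,
      lifts R p (phi \o (\val : [set z | 0 < a z] -> Z)) &
      lifts R q (phi \o (\val : [set z | 0 < b z] -> Z))].
Proof.
split=> [[s cs sphi]|[a [b [[ca cb] ab0 ab lp lq]]]]; last first.
  by apply: lifts_join_glue lp lq => // z; have [] := ab0 z.
have h01 z : 0 <= height z <= 1.
  rewrite -[z]reprK -/(pi _) height_pi; case: (repr _) => -[[|]|] /= y.
  - by rewrite lexx ler01.
  - by rewrite lexx ler01.
  - by rewrite unit_itv_ge0 unit_itv_le1.
exists (fun z => 1 - height (s z)), (fun z => height (s z)); split.
- split; last exact: (continuous_compT cs height_continuous).
  exact: (continuous_compT cs coheight_continuous).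
- by move=> z; have := h01 (s z); lra.
- move=> z; have [?|?] := ltP 0 (height (s z)); first by right.
  by left; lra.
- have cv : continuous (@set_map _ _ [set z | 0 < 1 - height (s z)]
    [set z | 0 < 1 - height z] s (fun z zU => zU)).
    exact: set_map_continuous.
  apply: lifts_homotopic (lifts_precomp cv lifts_join_left).
  by apply: homotopic_precomp sphi; exact: continuous_val.
- have cv : continuous (@set_map _ _ [set z | 0 < height (s z)]
    [set z | 0 < height z] s (fun z zU => zU)).
    exact: set_map_continuous.
  apply: lifts_homotopic (lifts_precomp cv lifts_join_right).
  by apply: homotopic_precomp sphi; exact: continuous_val.
Qed.
End JoinLifts.

(** * Associativity *)

Section CozeroJoin.
Variables (R : realType) (X : topologicalType).

(** All sources are quantified over because a join tests the property on subspaces of its source. *)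
Definition map_property := forall Z : topologicalType, (Z -> X) -> Prop.

Definition precomp_stable (A : map_property) :=
  forall (Y Z : topologicalType) (k : Y -> Z) (phi : Z -> X),
    continuous k -> A Z phi -> A Y (phi \o k).

Definition cozero_join (A B : map_property) : map_property := fun Z phi =>
  exists a b : Z -> R,
    [/\ continuous a /\ continuous b, forall z, 0 <= a z /\ 0 <= b z,
      forall z, 0 < a z \/ 0 < b z,
      A _ (phi \o (\val : [set z | 0 < a z] -> Z)) &
      B _ (phi \o (\val : [set z | 0 < b z] -> Z))].

(** Equality, rather than equivalence, allows rewriting inside iterated joins. *)
Lemma map_property_ext (A B : map_property) :
  (forall Z phi, A Z phi <-> B Z phi) -> A = B.
Proof.
move=> AB; apply: functional_extensionality_dep => Z.
by apply/funext => phi; exact/propext.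
Qed.

(** Moves a property between subspaces of [Z] and nested subspaces, which are distinct types. *)
Lemma precomp_stable_into (A : map_property) (Y Z : topologicalType)
    (U : set Z) (k : Y -> Z) (phi : Z -> X) :
  precomp_stable A -> continuous k -> (forall y, U (k y)) ->
  A _ (phi \o (\val : U -> Z)) -> A Y (phi \o k).
Proof.
move=> stA ck kU AU; apply: (stA _ _ (fun y => set_sub (kU y)) _ _ AU).
exact: continuous_into_set.
Qed.

Lemma precomp_stable_join (A B : map_property) :
  precomp_stable A -> precomp_stable B -> precomp_stable (cozero_join A B).
Proof.
move=> stA stB Y Z k phi ck [a [b [[ca cb] ab0 ab Aa Bb]]].
exists (a \o k), (b \o k); split.
- by split; exact: continuous_compT.
- by move=> y; exact: ab0.
- by move=> y; exact: ab.
- apply: (@precomp_stable_into A [set y | 0 < a (k y)] Z [set z | 0 < a z]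
    (k \o \val) phi stA _ _ Aa) => [|y].
    by apply: (continuous_compT _ ck); exact: continuous_val.
  exact: (set_typeP y).
- apply: (@precomp_stable_into B [set y | 0 < b (k y)] Z [set z | 0 < b z]
    (k \o \val) phi stB _ _ Bb) => [|y].
    by apply: (continuous_compT _ ck); exact: continuous_val.
  exact: (set_typeP y).
Qed.

Lemma cozero_joinC A B : cozero_join A B = cozero_join B A.
Proof.
have H A' B' (Z : topologicalType) (phi : Z -> X) :
    cozero_join A' B' phi -> cozero_join B' A' phi.
  move=> [a [b [[ca cb] ab0 ab Aa Bb]]]; exists b, a; split => // z.
    by have [] := ab0 z.
  by have [] := ab z; [right|left].
by apply: map_property_ext => Z phi; split; exact: H.
Qed.

(** The functions [a1] and [a2], defined only where [a] is positive, extend by zero to [w1] and [w2]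
    on [Z]; the regrouped cover is given by [w1] and [w2 + b], whose cozero set is the union of
    those of [w2] and [b]. *)
Lemma cozero_joinA A B C : precomp_stable A -> precomp_stable B ->
  precomp_stable C ->
  cozero_join (cozero_join A B) C = cozero_join A (cozero_join B C).
Proof.
have H A' B' C' (Z : topologicalType) (phi : Z -> X) :
    precomp_stable A' -> precomp_stable B' ->
    precomp_stable C' -> cozero_join (cozero_join A' B') C' phi ->
    cozero_join A' (cozero_join B' C') phi.
  move=> stA stB stC [a [b [[ca cb] ab0 ab]]].
  move=> [a1 [a2 [[ca1 ca2] a120 a12 Aa1 Ba2]]] Cb.
  have a0 z : 0 <= a z by have [] := ab0 z.
  have b0 z : 0 <= b z by have [] := ab0 z.
  have [x|w1 [cw1 w10 w1P]] := extend_cozero ca a0 ca1; first by have [] := a120 x.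
  have [x|w2 [cw2 w20 w2P]] := extend_cozero ca a0 ca2; first by have [] := a120 x.
  have lift (D : map_property) (v : _ -> R) (Y : topologicalType) (k : Y -> Z) :
      precomp_stable D -> continuous k ->
      (forall y, exists2 x : [set z | 0 < a z], \val x = k y & 0 < v x) ->
      D _ ((phi \o \val) \o (\val : [set x | 0 < v x] -> [set z | 0 < a z])) ->
      D _ (phi \o k).
    move=> stD ck kv Dv; have ka y : 0 < a (k y).
      by have [x <- _] := kv y; exact: (set_typeP x).
    apply: (@precomp_stable_into D _ _ [set x | 0 < v x]
      (fun y => @set_sub _ [set z | 0 < a z] _ (ka y)) (phi \o \val)) => //.
      exact: continuous_into_set.
    move=> y; have [x xk vx] := kv y; rewrite /= (_ : set_sub _ = x) //.
    exact: val_inj.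
  have cwb : continuous (fun z => w2 z + b z).
    by move=> z; apply: cvgD; [exact: cw2|exact: cb].
  exists w1, (fun z => w2 z + b z); split => //.
  - by move=> z; rewrite addr_ge0.
  - move=> z; have := b0 z; have := w20 z.
    case: (ab z) => [az|]; last by right; lra.
    have [a1z|a2z] := a12 (@set_sub _ [set z | 0 < a z] _ az).
      by left; apply/w1P; exists (@set_sub _ [set z | 0 < a z] _ az).
    suff : 0 < w2 z by right; lra.
    by apply/w2P; exists (@set_sub _ [set z | 0 < a z] _ az).
  - apply: (lift A' a1) => //; first exact: continuous_val.
    by move=> y; apply/w1P; exact: (set_typeP y).
  - exists (w2 \o \val), (b \o \val); split.
    + by split; apply: continuous_compT => //; exact: continuous_val.
    + by move=> z; rewrite w20 b0.
    + move=> z; have := set_typeP z; rewrite /= => wb.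
      have := w20 (\val z); have := b0 (\val z).
      by have [?|?] := ltP 0 (b (\val z)); [right|left; lra].
    + apply: (lift B' a2 [set x : [set z | 0 < w2 z + b z] | 0 < w2 (\val x)]
        (\val \o \val)) => //.
        exact: (continuous_compT (@continuous_val _ _) (@continuous_val _ _)).
      by move=> y; apply/w2P; exact: (set_typeP y).
    + apply: (@precomp_stable_into C'
        [set x : [set z | 0 < w2 z + b z] | 0 < b (\val x)] Z [set z | 0 < b z]
        (\val \o \val) phi stC _ _ Cb) => [|y].
        exact: (continuous_compT (@continuous_val _ _) (@continuous_val _ _)).
      exact: (set_typeP y).
move=> stA stB stC; apply: map_property_ext => Z phi; split; first exact: H.
(* By commutativity, the reverse implication is [H] for [C], [B], [A]. *)
rewrite cozero_joinC [cozero_join B C]cozero_joinC => /H.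
by rewrite cozero_joinC [cozero_join B A]cozero_joinC; apply.
Qed.

(** The [(n+1)]-fold join, indexed to match the Ganea maps. *)
Definition cozero_power (A : map_property) n :=
  iter n (fun B => cozero_join B A) A.

Lemma precomp_stable_power A n :
  precomp_stable A -> precomp_stable (cozero_power A n).
Proof. by move=> stA; elim: n => //= n IH; exact: precomp_stable_join. Qed.

Lemma cozero_powerD A m n : precomp_stable A ->
  cozero_join (cozero_power A m) (cozero_power A n) =
  cozero_power A (m + n).+1.
Proof.
move=> stA; elim: n => [|n IH]; first by rewrite addn0.
by rewrite addnS /= -cozero_joinA ?IH //; exact: precomp_stable_power.
Qed.

(** Counting factors, [(n + 1)(k + 1)] is one more than [n(k + 1) + k]. *)
Lemma cozero_powerM A k n : precomp_stable A ->
  cozero_power (cozero_power A k) n = cozero_power A (n * k.+1 + k).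
Proof.
move=> stA; elim: n => [//|n IH].
have -> : (n.+1 * k.+1 + k = (n * k.+1 + k + k).+1)%N by lia.
by rewrite -cozero_powerD // -IH.
Qed.

End CozeroJoin.

(** * Ganea maps as powers, and sectional category *)

Section SectionalCategory.
Variables (R : realType) (A X : topologicalType) (f : A -> X).
Hypothesis cf : continuous f.

Lemma precomp_stable_lifts (P : topologicalType) (p : P -> X) :
  precomp_stable (lifts R p).
Proof. by move=> Y Z k phi; exact: lifts_precomp. Qed.

Lemma lifts_ganea n :
  lifts R (@ganea_map R _ _ f n) = cozero_power R (lifts R f) n.
Proof.
elim: n => //= n IH; rewrite -/(cozero_power _ _ _) -IH.
apply: map_property_ext => Z phi.
by apply: lifts_joinP => //; exact: ganea_map_continuous.
Qed.

Lemma has_homotopy_sectionE (P : topologicalType) (p : P -> X) :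
  has_homotopy_section R p <-> lifts R p idfun.
Proof. by split=> [[s [cs sp]]|[s cs sp]]; exists s. Qed.

Lemma has_homotopy_section_ganeaS n :
  has_homotopy_section R (@ganea_map R _ _ f n) ->
  has_homotopy_section R (@ganea_map R _ _ f n.+1).
Proof.
move=> [s [cs sid]]; exists (@ganea_gamma R _ _ f n \o s); split.
  by apply: (continuous_compT cs); exact: hpushout_inl_continuous.
rewrite (_ : _ \o _ = @ganea_map R _ _ f n \o s) //.
by apply/funext => x; exact: ganea_map_gamma.
Qed.

(** Minimality gives one direction; for the other, a section at stage [m] climbs to stage [n] along
    the maps [ganea_gamma]. *)
Lemma secat_leP n : has_homotopy_section R (@ganea_map R _ _ f n) <->
  exists2 m, secat R f = Some m & (m <= n)%N.
Proof.
rewrite /secat; case: pselect => [ex|nex]; last first.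
  by split=> [sn|[]//]; case: nex; exists n; apply/asboolP.
case: ex_minnP => m /asboolP sm mmin; split=> [sn|[_ [<-] mn]].
  by exists m => //; apply/mmin/asboolP.
rewrite -(subnK mn); elim: (n - m)%N => // d.
exact: has_homotopy_section_ganeaS.
Qed.

End SectionalCategory.

Theorem proposition4 (R : realType) (A X : topologicalType) (iota : A -> X)
    (iota_cont : continuous iota) (k : nat) :
  secat R (@ganea_map R A X iota k) =
  omap (fun q : nat => (q %/ k.+1)%N) (secat R iota).
Proof.
have ck := @ganea_map_continuous R A X iota k iota_cont.
(* Both sides say that the identity of [X] has the [(n+1)(k+1)]-fold power of lifting through
   [iota]. *)
have sectionE n :
    has_homotopy_section R (@ganea_map R _ _ (@ganea_map R _ _ iota k) n) <->
    has_homotopy_section R (@ganea_map R _ _ iota (n * k.+1 + k)).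
  rewrite !has_homotopy_sectionE !lifts_ganea // cozero_powerM //.
  exact: precomp_stable_lifts.
(* The two sides of the theorem have the same finite upper bounds, with [None] having none. *)
have leE n :
    (exists2 m, secat R (@ganea_map R A X iota k) = Some m & (m <= n)%N) <->
    (exists2 q, secat R iota = Some q & (q %/ k.+1 <= n)%N).
  rewrite -secat_leP // sectionE secat_leP //.
  (* Both inequalities mean [q < (n + 1)(k + 1)]. *)
  have divE q : (q <= n * k.+1 + k)%N = (q %/ k.+1 <= n)%N.
    by rewrite -ltnS -[RHS]ltnS ltn_divLR // mulSn addSn addnC.
  by split=> -[q -> qn]; exists q; rewrite // ?divE // -divE.
case E: (secat R iota) leE => [q|] leE /=.
  (* Each value is tested as an upper bound of the other, and antisymmetry concludes. *)
  have [|m gm mq] := (leE (q %/ k.+1)%N).2; first by exists q.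
  have [|_ [<-] qm] := (leE m).1; first by exists m.
  by rewrite gm; congr Some; apply/eqP; rewrite eqn_leq mq.
case E': (secat R _) => [m|] //.
by have [|q] := (leE m).1; first by exists m.
Qed.
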